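(* Fix integers $n\geq1$, $m\geq1$ and let $p\in(0,1)$, $q=1-p$. Let $\pi\sim\nu^{(p)}_{n,m}$ and $D_n^{\leftarrow}:=\operatorname{des}(\pi^{-1})$. Then, as formal power series in $t$, $$\mathbb{E}\left[t^{D_n^{\leftarrow}+1}\right]=(1-t)^{n+1}\sum_{k\geq1}t^k\,[z^n]\left(\frac{1+qz/m}{1-pz/m}\right)^{km}.$$
   Context: Asymmetric shelf shuffle: let $m\ge 1$ be an integer, $p\in(0,1)$, $q=1-p$. A deck of $n$ cards labelled $1,\ldots,n$ from top to bottom is dealt sequentially from the bottom (card $n$ first, card $1$ last). Each card is assigned to one of $m$ labelled shelves independently and uniformly at random, and is placed at the top of the existing pile on that shelf with probability $p$ and at the bottom with probability $q$, independently of everything else. The shuffled deck is formed by joining the piles in shelf order (shelf $1$ on top, then shelf $2$, and so on). The resulting random permutation is $\pi=(\pi_1,\ldots,\pi_n)\in S_n$, where $\pi_i$ is the label of the card in position $i$ from the top, and $\nu^{(p)}_{n,m}$ denotes its law on $S_n$. $\operatorname{des}(\sigma)=|\{i\in\{1,\ldots,n-1\}:\sigma_i>\sigma_{i+1}\}|$ is the number of descents of $\sigma\in S_n$. $[z^n]$ denotes the coefficient of $z^n$ in a formal power series. *)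

(* Defs.v *)
(* MathComp; boolp supplies extensionality for formal power series. *)
From HB Require Import structures.
From mathcomp Require Import all_boot all_order all_algebra all_fingroup.
From mathcomp Require Import boolp.

Set Implicit Arguments.
Unset Strict Implicit.
Unset Printing Implicit Defensive.

Import Order.TTheory GRing.Theory Num.Theory.

Local Open Scope ring_scope.

(* Formal power series in one variable; [fcoef f d] is the coefficient of
   degree d. The wrapper avoids the pointwise product on nat -> R. *)
Record fps (R : fieldType) := Fps { fcoef : nat -> R }.

Lemma fpsP (R : fieldType) (f g : fps R) :
  (forall d, fcoef f d = fcoef g d) -> f = g.
Proof. by case: f g => [f] [g] /= H; congr Fps; apply/funext. Qed.

HB.instance Definition _ (R : fieldType) := gen_eqMixin (fps R).
HB.instance Definition _ (R : fieldType) := gen_choiceMixin (fps R).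

Section FpsRing.
Variable R : fieldType.
Implicit Types f g h : fps R.

Definition fps_zero : fps R := Fps (fun=> 0).
Definition fps_opp f := Fps (fun d => - fcoef f d).
Definition fps_add f g := Fps (fun d => fcoef f d + fcoef g d).

Lemma fps_addA : associative fps_add.
Proof. by move=> f g h; apply: fpsP => d /=; rewrite addrA. Qed.
Lemma fps_addC : commutative fps_add.
Proof. by move=> f g; apply: fpsP => d /=; rewrite addrC. Qed.
Lemma fps_add0 : left_id fps_zero fps_add.
Proof. by move=> f; apply: fpsP => d /=; rewrite add0r. Qed.
Lemma fps_addN : left_inverse fps_zero fps_opp fps_add.
Proof. by move=> f; apply: fpsP => d /=; rewrite addNr. Qed.

HB.instance Definition _ :=
  GRing.isZmodule.Build (fps R) fps_addA fps_addC fps_add0 fps_addN.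

Definition fps_one : fps R := Fps (fun d => (d == 0)%:R).
Definition fps_mul f g :=
  Fps (fun d => \sum_(i < d.+1) fcoef f i * fcoef g (d - i)).

Definition fps_trunc d f : {poly R} := \poly_(i < d.+1) fcoef f i.

Lemma fps_coefM f g d (P Q : {poly R}) :
    (forall i, (i <= d)%N -> P`_i = fcoef f i) ->
    (forall i, (i <= d)%N -> Q`_i = fcoef g i) ->
  (P * Q)`_d = fcoef (fps_mul f g) d.
Proof.
move=> HP HQ; rewrite coefM; apply: eq_bigr => i _.
by rewrite HP ?HQ ?leq_subr // -ltnS.
Qed.

Lemma coef_fps_trunc d f i : (i <= d)%N -> (fps_trunc d f)`_i = fcoef f i.
Proof. by move=> le_id; rewrite coef_poly ltnS le_id. Qed.

Lemma coef_fps_truncM d f g i : (i <= d)%N ->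
  (fps_trunc d f * fps_trunc d g)`_i = fcoef (fps_mul f g) i.
Proof.
move=> le_id; apply: fps_coefM => j le_ji;
  by rewrite coef_fps_trunc ?(leq_trans le_ji).
Qed.

Lemma fps_mulA : associative fps_mul.
Proof.
move=> f g h; apply: fpsP => d.
transitivity ((fps_trunc d f * fps_trunc d g * fps_trunc d h)`_d).
  rewrite -mulrA; apply/esym/fps_coefM => i;
    [exact: coef_fps_trunc | exact: coef_fps_truncM].
apply: fps_coefM => i; [exact: coef_fps_truncM | exact: coef_fps_trunc].
Qed.

Lemma fps_mulC : commutative fps_mul.
Proof.
by move=> f g; apply: fpsP => d; rewrite -!(@coef_fps_truncM d) // mulrC.
Qed.

Lemma fps_mul1 : left_id fps_one fps_mul.
Proof.
move=> f; apply: fpsP => d /=.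
by rewrite big_ord_recl big1 ?addr0 ?mul1r ?subn0 // => i _; rewrite mul0r.
Qed.

Lemma fps_mulDl : left_distributive fps_mul fps_add.
Proof.
move=> f g h; apply: fpsP => d /=; rewrite -big_split /=.
by apply: eq_bigr => i _; rewrite mulrDl.
Qed.

Lemma fps_one_neq0 : fps_one != 0.
Proof.
apply/eqP => /(congr1 (fun f => fcoef f 0)) /= /eqP.
by rewrite oner_eq0.
Qed.

HB.instance Definition _ := GRing.Zmodule_isComNzRing.Build (fps R)
  fps_mulA fps_mulC fps_mul1 fps_mulDl fps_one_neq0.

(* The coefficients of degree <= d of the inverse of f, from
   f_0 g_0 = 1 and f_0 g_{d+1} = - \sum_(i <= d) f_{i+1} g_{d-i}. *)
Fixpoint fps_inv_coefs f d : seq R :=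
  if d is d'.+1 then
    let s := fps_inv_coefs f d' in
    rcons s (- ((fcoef f 0)^-1 * \sum_(i < d) fcoef f i.+1 * s`_(d' - i)))
  else [:: (fcoef f 0)^-1].

Definition fps_unit : {pred fps R} := [pred f | fcoef f 0 != 0].

(* As for GRing.inv, non-units are left unchanged. *)
Definition fps_inv f :=
  if f \in fps_unit then Fps (fun d => (fps_inv_coefs f d)`_d) else f.

Lemma size_fps_inv_coefs f d : size (fps_inv_coefs f d) = d.+1.
Proof. by elim: d => //= d IHd; rewrite size_rcons IHd. Qed.

Lemma nth_fps_inv_coefs f d i : (i <= d)%N ->
  (fps_inv_coefs f d)`_i = (fps_inv_coefs f i)`_i.
Proof.
elim: d => [|d IHd]; first by rewrite leqn0 => /eqP->.
rewrite leq_eqVlt => /predU1P[-> // | lt_id].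
by rewrite /= nth_rcons size_fps_inv_coefs lt_id IHd.
Qed.

Lemma fps_mulV : {in fps_unit, left_inverse 1 fps_inv *%R}.
Proof.
move=> f Uf; rewrite mulrC /fps_inv Uf; apply: fpsP => -[|d].
  by rewrite /= big_ord_recl big_ord0 addr0 /= mulfV.
rewrite /GRing.mul /= big_ord_recl subn0 /=.
rewrite nth_rcons size_fps_inv_coefs ltnn eqxx mulrN mulVKf //.
apply/eqP; rewrite addrC subr_eq0; apply/eqP/eq_bigr => i _.
by rewrite /bump leq0n add1n subSS -(@nth_fps_inv_coefs _ d) ?leq_subr.
Qed.

Lemma fps_unitP f g : g * f = 1 -> f \in fps_unit.
Proof.
move/(congr1 (fun h => fcoef h 0)).
rewrite /GRing.mul /= big_ord_recl big_ord0 addr0 subn0 /= => gf1.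
rewrite inE; apply: contra_eq_neq gf1 => ->.
by rewrite mulr0 eq_sym oner_neq0.
Qed.

Lemma fps_inv_out : {in [predC fps_unit], fps_inv =1 id}.
Proof. by move=> f /negPf nUf; rewrite /fps_inv nUf. Qed.

HB.instance Definition _ := GRing.ComNzRing_hasMulInverse.Build (fps R)
  fps_mulV fps_unitP fps_inv_out.

Definition fps_of_poly (P : {poly R}) : fps R := Fps (fun d => P`_d).

End FpsRing.

Section ShelfShuffle.
Variables (R : realFieldType) (n m : nat) (p : R).

(* The card labelled i+1 is i : 'I_n, and shelf j+1 is j : 'I_m. A pile is
   listed from top to bottom. For each card, an outcome records its shelf and
   whether it goes to the top (true) or to the bottom (false) of the pile. *)
Definition outcome := {ffun 'I_n -> 'I_m * bool}.

Definition outcome_prob (w : outcome) : R :=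
  \prod_(c < n) (m%:R^-1 * (if (w c).2 then p else 1 - p)).

Definition place (w : outcome) (piles : 'I_m -> seq 'I_n) (c : 'I_n) :
    'I_m -> seq 'I_n :=
  fun s => if s == (w c).1 then
             if (w c).2 then c :: piles s else rcons (piles s) c
           else piles s.

Definition deal (w : outcome) : 'I_m -> seq 'I_n :=
  foldl (place w) (fun=> [::]) (rev (enum 'I_n)).

Definition deck (w : outcome) : seq 'I_n :=
  flatten [seq deal w s | s <- enum 'I_m].

(* nu^(p)_{n,m}; sigma is read as the word sigma_1 ... sigma_n giving the
   label in each position from the top. *)
Definition shelf_law (sigma : 'S_n) : R :=
  \sum_(w : outcome | deck w == [seq sigma i | i <- enum 'I_n])
    outcome_prob w.

Lemma deck_perm_eq (w : outcome) : perm_eq (deck w) (enum 'I_n).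
Proof.
have count_flat a (P : 'I_m -> seq 'I_n) :
    count a (flatten [seq P s | s <- enum 'I_m]) = (\sum_s count a (P s))%N.
  by rewrite count_flatten -map_comp sumnE big_map big_enum.
have placeE a P c : (\sum_s count a (place w P c s) =
    a c + \sum_s count a (P s))%N.
  rewrite (bigD1 (w c).1) //= [in RHS](bigD1 (w c).1) //= addnA; congr (_ + _)%N.
    rewrite /place eqxx; case: ifP => // _.
    by rewrite -cats1 count_cat /= addn0 addnC.
  by apply: eq_bigr => s /negPf ns; rewrite /place ns.
apply/seq.permP => a; rewrite count_flat /deal -(count_rev a (enum 'I_n)).
have foldE (s : seq 'I_n) (P : 'I_m -> seq 'I_n) :
    (\sum_j count a (foldl (place w) P s j) =
     \sum_j count a (P j) + count a s)%N.
  elim: s P => [|c s IHs] P /=; first by rewrite addn0.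
  by rewrite IHs placeE addnCA addnA.
by rewrite foldE big1.
Qed.

Lemma sum_shelf_law : (0 < m)%N -> \sum_(sigma : 'S_n) shelf_law sigma = 1.
Proof.
move=> m_gt0; rewrite /shelf_law (exchange_big_dep xpredT) //=.
transitivity (\sum_(w : outcome) outcome_prob w).
  apply: eq_bigr => w _.
  have sz : size (deck w) = n by rewrite (perm_size (deck_perm_eq w)) size_enum_ord.
  have Ud : uniq (deck w) by rewrite (perm_uniq (deck_perm_eq w)) enum_uniq.
  pose f (i : 'I_n) : 'I_n := nth i (deck w) i.
  have f_inj : injective f.
    move=> i j; rewrite /f (set_nth_default i j) ?sz // => /eqP.
    by rewrite nth_uniq ?sz // => /eqP/val_inj.
  have deckE : deck w = [seq perm f_inj i | i <- enum 'I_n].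
    case En: (deck w) => [|x0 d].
      by apply/esym/size0nil; rewrite size_map size_enum_ord -sz En.
    rewrite -En; apply: (@eq_from_nth _ x0); first by rewrite size_map size_enum_ord.
    move=> i; rewrite sz => lt_in.
    rewrite (nth_map x0) ?size_enum_ord // permE /f nth_enum_ord //.
    by rewrite (set_nth_default x0) ?sz.
  rewrite (big_pred1 (perm f_inj)) // => sigma /=; rewrite deckE.
  apply/eqP/eqP => [E | -> //]; apply/permP => i.
  by move/eq_in_map: E => /(_ i) ->; rewrite ?mem_enum.
rewrite /outcome_prob.
rewrite -(bigA_distr_bigA (fun (c : 'I_n) (x : 'I_m * bool) =>
  m%:R^-1 * (if x.2 then p else 1 - p))) big1 // => c _.
rewrite -(pair_bigA _ (fun (s : 'I_m) (b : bool) =>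
  m%:R^-1 * (if b then p else 1 - p))) /=.
under eq_bigr do rewrite big_bool /= -mulrDr addrC subrK mulr1.
by rewrite sumr_const card_ord -[LHS]mulr_natl mulfV // pnatr_eq0 -lt0n.
Qed.

End ShelfShuffle.

Definition des (n : nat) (sigma : 'S_n) : nat :=
  #|[set i : 'I_n | [exists j : 'I_n,
      (val j == i.+1) && (val (sigma j) < val (sigma i))%N]]|.

(* E[t^X] for a statistic X of sigma ~ law, a polynomial in t = 'X. *)
Definition gen_fun (R : realFieldType) (n : nat) (law : 'S_n -> R)
    (X : 'S_n -> nat) : {poly R} :=
  \sum_(sigma : 'S_n) law sigma *: 'X^(X sigma).

(* Main.v *)
From HB Require Import structures.
Require Import Defs.
From mathcomp Require Import all_boot all_order all_algebra all_fingroup.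
From mathcomp Require Import ring.

Set Implicit Arguments.
Unset Strict Implicit.
Unset Printing Implicit Defensive.

Import Order.TTheory GRing.Theory Num.Theory.

Local Open Scope ring_scope.

(** The outcome of a shuffle is a word of [n] letters, the letter of a card
    being its shelf together with the choice top or bottom. Cards on one shelf
    end up as the top-placed ones in increasing order followed by the
    bottom-placed ones in decreasing order. Hence card [c+1] lies above card
    [c] iff it has a strictly smaller shelf, or the same shelf while [c] went
    to the bottom: this is a relation [letter_desc] between the two consecutive
    letters alone, so that [des sigma^-1] is the number of descents of the word
    for this relation ([des_deck]), and the expectation is a weighted
    enumeration of words by descents.

    Put [k] ordered copies of the alphabet one after the other. In a
    nondecreasing sequence of letters of this long alphabet, where a top letter
    may be repeated and a bottom letter may not, the copy index is weakly
    increasing, and strictly so at each descent of the underlying word. Thus a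
    word with [d] descents is underlain by 'C(n + k - d - 1, n) sequences,
    which is the coefficient of [t^k] in [t^(d+1) / (1-t)^(n+1)]. On the other
    hand, a top letter contributes the factor [1 / (1 - (p/m) z)] and a bottom
    letter the factor [1 + (q/m) z], so these sequences are enumerated by the
    power [k * m] of the quotient [U] in the theorem.

    The argument is carried out on series. Let [c a] enumerate the
    nondecreasing sequences that start with the letter [a], one [z] being
    divided out, in a single copy, and let [E] enumerate all nondecreasing
    sequences in one copy. Then [c a * E ^+ k] enumerates those in [k+1] copies
    that start with [a] in the first copy. The equations
      c a = x a * (1 + z * sum of the c b over the b not a descent after a)
      E   = 1 + z * sum of all c b
    are the only properties of the alphabet that matter: they yield the
    recursion on the length that the descent polynomials of words satisfy
    ([chains_rec], [chains_gf]), whence the formula ([word_gf_series]). For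
    shelves, [c] has a closed form in terms of [U] ([shelf_chains]), and the
    two equations follow from [U = 1 + z * ((p/m) * U + q/m)] by telescoping. *)

(** * Coefficients of power series *)

Section SeriesOfPoly.
Variable R : fieldType.
Implicit Types (f g : fps R) (P Q : {poly R}).

Lemma fps_of_poly_is_zmod_morphism : zmod_morphism (@fps_of_poly R).
Proof. by move=> P Q; apply: fpsP => d /=; rewrite coefB. Qed.

Lemma fps_of_poly_is_monoid_morphism : monoid_morphism (@fps_of_poly R).
Proof.
by split=> [|P Q]; apply: fpsP => d /=; rewrite ?coef1 ?coefM.
Qed.

HB.instance Definition _ := GRing.isZmodMorphism.Build {poly R} (fps R)
  (@fps_of_poly R) fps_of_poly_is_zmod_morphism.
HB.instance Definition _ := GRing.isMonoidMorphism.Build {poly R} (fps R)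
  (@fps_of_poly R) fps_of_poly_is_monoid_morphism.

Lemma fcoefD f g d : fcoef (f + g) d = fcoef f d + fcoef g d.
Proof. by []. Qed.

Lemma fcoefB f g d : fcoef (f - g) d = fcoef f d - fcoef g d.
Proof. by []. Qed.

Lemma fcoef0M f g : fcoef (f * g) 0 = fcoef f 0 * fcoef g 0.
Proof. by rewrite /= big_ord1. Qed.

Lemma fcoef_sum (I : finType) (P : pred I) (F : I -> fps R) d :
  fcoef (\sum_(i | P i) F i) d = \sum_(i | P i) fcoef (F i) d.
Proof. exact: (big_morph (fun f => fcoef f d) (fun _ _ => erefl) erefl). Qed.

Lemma fcoef_polyCM a f d : fcoef (fps_of_poly a%:P * f) d = a * fcoef f d.
Proof.
rewrite /= big_ord_recl coefC subn0 big1 ?addr0 // => i _.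
by rewrite coefC mul0r.
Qed.

Lemma fcoef_XM f d :
  fcoef (fps_of_poly 'X * f) d = if d is d'.+1 then fcoef f d' else 0.
Proof.
case: d => [|d] /=; first by rewrite big_ord1 coefX mul0r.
rewrite big_ord_recl coefX mul0r add0r big_ord_recl coefX mul1r subSS subn0.
by rewrite big1 ?addr0 // => i _; rewrite coefX mul0r.
Qed.

Lemma fcoef_1subXM f d : fcoef (fps_of_poly (1 - 'X) * f) d =
  fcoef f d - (if d is d'.+1 then fcoef f d' else 0).
Proof. by rewrite -fcoef_XM rmorphB rmorph1 mulrBl mul1r. Qed.

End SeriesOfPoly.

(** * Enumeration of words by descents *)

Section Words.
Variables (R : fieldType) (A : finType) (desc : rel A) (x : A -> R).

Definition word_des n (w : {ffun 'I_n.+1 -> A}) : nat :=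
  \sum_(i < n) desc (w (widen_ord (leqnSn n) i)) (w (lift ord0 i)).

(** Generating polynomial, by descents, of the words of length [n.+1] with
    first letter [a]; the recursion removes that letter. *)
Fixpoint word_gf n (a : A) : {poly R} :=
  if n is n'.+1 then
    x a *: \sum_b 'X^(desc a b) * word_gf n' b
  else (x a)%:P.

Definition ffun_cons n (a : A) (w : {ffun 'I_n -> A}) : {ffun 'I_n.+1 -> A} :=
  [ffun i => oapp w a (unlift ord0 i)].

Lemma ffun_cons0 n a (w : {ffun 'I_n -> A}) : ffun_cons a w ord0 = a.
Proof. by rewrite ffunE unlift_none. Qed.

Lemma ffun_consS n a (w : {ffun 'I_n -> A}) i :
  ffun_cons a w (lift ord0 i) = w i.
Proof. by rewrite ffunE liftK. Qed.

Lemma word_des_cons n a (w : {ffun 'I_n.+1 -> A}) :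
  word_des (ffun_cons a w) = (desc a (w ord0) + word_des w)%N.
Proof.
have w0 : widen_ord (leqnSn n.+1) ord0 = ord0 by apply: val_inj.
have wS i : widen_ord (leqnSn n.+1) (lift ord0 i) =
    lift ord0 (widen_ord (leqnSn n) i) by apply: val_inj.
rewrite /word_des big_ord_recl w0 ffun_cons0 ffun_consS.
by under eq_bigr do rewrite wS !ffun_consS.
Qed.

Lemma sum_ffun_cons (V : nmodType) n (F : {ffun 'I_n.+1 -> A} -> V) :
  \sum_w F w = \sum_a \sum_w F (ffun_cons a w).
Proof.
rewrite pair_bigA.
rewrite (reindex (fun aw : A * {ffun 'I_n -> A} => ffun_cons aw.1 aw.2)) //=.
exists (fun w : {ffun 'I_n.+1 -> A} => (w ord0, [ffun i => w (lift ord0 i)])).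
  move=> [a w] _; rewrite ffun_cons0; congr pair.
  by apply/ffunP => i; rewrite ffunE ffun_consS.
move=> w _; apply/ffunP => i; case: (unliftP ord0 i) => [j|] ->.
  by rewrite ffun_consS ffunE.
by rewrite ffun_cons0.
Qed.

Lemma word_gfE n a :
  \sum_(w : {ffun 'I_n -> A})
    (\prod_i x (ffun_cons a w i)) *: 'X^(word_des (ffun_cons a w)) =
  word_gf n a.
Proof.
elim: n a => [|n IHn] a /=.
  rewrite (big_pred1 [ffun i : 'I_0 => a]) => [|w]; last first.
    by apply/esym/eqP/ffunP => -[].
  by rewrite big_ord1 ffun_cons0 /word_des big_ord0 alg_polyC.
rewrite sum_ffun_cons scaler_sumr; apply: eq_bigr => b _.
rewrite -IHn mulr_sumr scaler_sumr; apply: eq_bigr => w _.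
rewrite big_ord_recl ffun_cons0 word_des_cons ffun_cons0.
rewrite (eq_bigr (fun i => x (ffun_cons b w i))) => [|i _]; last first.
  by rewrite ffun_consS.
by rewrite exprD -scalerA -scalerAr.
Qed.

Lemma sum_word_gf n :
  \sum_(w : {ffun 'I_n.+1 -> A}) (\prod_i x (w i)) *: 'X^(word_des w) =
  \sum_a word_gf n a.
Proof. by rewrite sum_ffun_cons; apply: eq_bigr => a _; apply: word_gfE. Qed.

(** From here on [c] and [E] are any solution of the two equations for
    nondecreasing sequences in a single copy of the alphabet. *)
Variables (c : A -> fps R) (E : fps R).
Hypothesis cE : forall a, c a =
  fps_of_poly (x a)%:P * (1 + fps_of_poly 'X * \sum_(b | ~~ desc a b) c b).
Hypothesis EE : E = 1 + fps_of_poly 'X * \sum_b c b.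

(** The coefficient of [t^k] counts the nondecreasing sequences of length
    [n.+1] in [k.+1] copies of the alphabet that start with the letter [a] of
    the first copy. *)
Let chains n a : fps R := Fps (fun k => fcoef (c a * E ^+ k) n).

Let chainsE n a k : fcoef (chains n a) k = fcoef (c a * E ^+ k) n.
Proof. by []. Qed.

(** Multiplying by [1 - t] compares successive numbers of copies: at [t^(k+1)]
    it gives the difference of [c a * E ^+ k.+1] and [c a * E ^+ k]. What is
    left is the sequences whose second letter [b] lies in the earliest
    admissible copy: the first one if [b] is no descent after [a], else the
    second one, which leaves one copy less and so costs a factor [t]. *)
Lemma chains_rec n a : fps_of_poly (1 - 'X) * chains n.+1 a =
  fps_of_poly (x a)%:P * \sum_b fps_of_poly 'X^(desc a b) * chains n b.
Proof.
apply: fpsP => k; rewrite fcoef_1subXM fcoef_polyCM fcoef_sum.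
pose ok := \sum_(b | ~~ desc a b) c b; pose de := \sum_(b | desc a b) c b.
have EokE : E = 1 + fps_of_poly 'X * (ok + de).
  by rewrite EE (bigID (desc a)) /= [ok + de]addrC.
(* The factor t shifts the index, so a descent trades one power of E. *)
have tailE b k' : fcoef (fps_of_poly 'X^(desc a b) * chains n b) k' =
    if desc a b then (if k' is k''.+1 then fcoef (c b * E ^+ k'') n else 0)
    else fcoef (c b * E ^+ k') n.
  by case: (desc a b); rewrite ?expr1 ?fcoef_XM // rmorph1 mul1r.
under eq_bigr do rewrite tailE.
case: k => [|k].
  rewrite subr0 chainsE expr0 mulr1 cE fcoef_polyCM.
  congr (_ * _).
  rewrite fcoefD fcoef_XM [fcoef 1 _]/= add0r.
  rewrite fcoef_sum big_mkcond.
  by apply: eq_bigr => b _; rewrite mulr1; case: (desc a b).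
rewrite !chainsE -fcoefB.
have -> : c a * E ^+ k.+1 - c a * E ^+ k =
    fps_of_poly (x a)%:P * (fps_of_poly 'X * (de * E ^+ k + ok * E ^+ k.+1)).
  rewrite cE -/ok exprS; set P := E ^+ k; rewrite EokE; ring.
rewrite fcoef_polyCM fcoef_XM fcoefD [in RHS](bigID (desc a)).
congr (_ * (_ + _)).
  rewrite mulr_suml fcoef_sum; apply: eq_bigr => b ab.
  by rewrite ab.
rewrite mulr_suml fcoef_sum; apply: eq_bigr => b /negPf ab.
by rewrite ab.
Qed.

(** Each letter costs one factor [1 - t]: one for the first by the geometric
    series, and one for each further letter by the recursion. *)
Lemma chains_gf n a :
  fps_of_poly (1 - 'X) ^+ n.+1 * chains n a = fps_of_poly (word_gf n a).
Proof.
elim: n a => [|n IHn] a.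
  rewrite expr1; apply: fpsP => k; rewrite fcoef_1subXM.
  have E0 : fcoef E 0 = 1 by rewrite EE fcoefD fcoef_XM addr0.
  have Ej0 j : fcoef (E ^+ j) 0 = 1.
    by elim: j => // j IHj; rewrite exprS fcoef0M E0 IHj mulr1.
  have c0 : fcoef (c a) 0 = x a.
    by rewrite cE fcoef_polyCM fcoefD fcoef_XM addr0 mulr1.
  have F0 j : fcoef (chains 0 a) j = x a.
    by rewrite chainsE fcoef0M c0 Ej0 mulr1.
  by case: k => [|k]; rewrite !F0 /= coefC ?subr0 ?subrr.
rewrite exprSr -mulrA chains_rec mulrCA /= -mul_polyC rmorphM rmorph_sum.
congr (_ * _); rewrite mulr_sumr; apply: eq_bigr => b _.
by rewrite mulrCA IHn rmorphM.
Qed.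

(** The sequences in [k.+1] copies that are not confined to the last [k]
    start in the first copy: [E ^+ k.+1 - E ^+ k = z * \sum_a c a * E ^+ k].
    Summing over the copy of the first letter thus accounts for one more
    factor [1 - t] than in [chains_gf], and the shift from [k] to [k.+1] for
    the factor [t]. *)
Lemma word_gf_series n :
  fps_of_poly (1 - 'X) ^+ n.+2 *
    Fps (fun k => if (1 <= k)%N then fcoef (E ^+ k) n.+1 else 0) =
  fps_of_poly ('X * \sum_a word_gf n a).
Proof.
rewrite [_ ^+ n.+2]exprSr -mulrA rmorphM rmorph_sum.
rewrite (eq_bigr _ (fun a _ => esym (chains_gf n a))).
rewrite -mulr_sumr [RHS]mulrCA; congr (_ * _); apply: fpsP => k.
rewrite fcoef_1subXM fcoef_XM; case: k => [|k]; first by rewrite subrr.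
rewrite [fcoef (Fps _) _]/= fcoef_sum.
have -> : fcoef (Fps (fun k =>
    if (1 <= k)%N then fcoef (E ^+ k) n.+1 else 0)) k = fcoef (E ^+ k) n.+1.
  by case: k.
rewrite -fcoefB.
have -> : E ^+ k.+1 - E ^+ k = fps_of_poly 'X * \sum_b c b * E ^+ k.
  by rewrite -mulr_suml exprS; set P := E ^+ k; rewrite EE; ring.
by rewrite fcoef_XM fcoef_sum.
Qed.
End Words.

(** * Descents of the inverse shuffle *)

Definition letter_desc (m : nat) : rel ('I_m * bool) :=
  fun a b => (b.1 < a.1)%N || (b.1 == a.1) && ~~ a.2.

Section Deck.
Variables (n m : nat) (w : outcome n m).

(** The order of two cards in the deck as read off their letters. The test
    [c < d] enters because the smaller card is dealt later: on a common shelf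
    it is the card whose placement relative to the other one decides. *)
Definition above : rel 'I_n := fun c d =>
  ((w c).1 < (w d).1)%N ||
  ((w c).1 == (w d).1) && (if (c < d)%N then (w c).2 else ~~ (w d).2).

Lemma aboveS (c d : 'I_n) : val d = c.+1 ->
  (above c d = ~~ letter_desc (w c) (w d)) *
  (above d c = letter_desc (w c) (w d)).
Proof.
rewrite /above /letter_desc => /= ->.
rewrite ltnSn [(c.+1 < c)%N]ltnNge leqnSn /= -!val_eqE /=.
by case: ltngtP => // _; rewrite negbK.
Qed.

(** Invariant of the dealing: [s] lists the cards already dealt, the latest
    one first, so a new card is smaller than every card of the pile and its own
    placement alone settles its position relative to them. *)
Lemma pile_pairwise (s : seq 'I_n) (j : 'I_m) :
    pairwise (fun c d : 'I_n => (c < d)%N) s ->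
  let pile := foldr (fun c P => place w P c) (fun=> [::]) s j in
  all (fun c => (c \in s) && ((w c).1 == j)) pile && pairwise above pile.
Proof.
elim: s => [|c s IHs] //= /andP[c_min /IHs/andP[pile_s pile_ord]].
rewrite [place _ _ _ _]/place; set pile := foldr _ _ _ _ in pile_s pile_ord *.
have c_lt d : d \in pile -> (c < d)%N /\ (w d).1 = j.
  by move=> /(allP pile_s)/andP[/(allP c_min) ? /eqP].
have pile_cs : all (fun d => (d \in c :: s) && ((w d).1 == j)) pile.
  by apply: sub_all pile_s => d /andP[ds ->]; rewrite inE ds orbT.
case: eqP => [jE | _]; last by rewrite pile_cs pile_ord.
case: ifP => [top | bottom].
  rewrite /= pile_cs pile_ord inE -jE !eqxx /= andbT.
  apply/allP => d /c_lt[cd dj].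
  by rewrite /above dj -jE cd top eqxx orbT.
rewrite all_rcons pile_cs pairwise_rcons pile_ord inE -jE !eqxx /= andbT.
apply/allP => d /c_lt[cd dj].
by rewrite /above dj -jE [(d < c)%N]ltnNge (ltnW cd) /= bottom eqxx orbT.
Qed.

Lemma deal_pairwise (j : 'I_m) :
  all (fun c => (w c).1 == j) (deal w j) && pairwise above (deal w j).
Proof.
have lt_enum : pairwise (fun c d : 'I_n => (c < d)%N) (enum 'I_n).
  rewrite -(pairwise_map (val : 'I_n -> nat) ltn) val_enum_ord.
  by rewrite -(sorted_pairwise ltn_trans) iota_ltn_sorted.
have := pile_pairwise j lt_enum; rewrite /deal foldl_rev => /andP[pile_j ->].
by rewrite andbT; apply: sub_all pile_j => c /andP[].
Qed.

Lemma deck_pairwise : pairwise above (deck w).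
Proof.
have lt_enum : pairwise (fun i j : 'I_m => (i < j)%N) (enum 'I_m).
  rewrite -(pairwise_map (val : 'I_m -> nat) ltn) val_enum_ord.
  by rewrite -(sorted_pairwise ltn_trans) iota_ltn_sorted.
rewrite /deck; elim: (enum 'I_m) lt_enum => //= i s IHs /andP[i_min /IHs s_ord].
have /andP[/allP pile_i pile_ord] := deal_pairwise i.
rewrite pairwise_cat pile_ord s_ord !andbT; apply/allrelP => c d /pile_i/eqP ci.
case/flatten_mapP => j js dj.
have /andP[/allP/(_ d dj)/eqP jE _] := deal_pairwise j.
by rewrite /above ci jE (allP i_min).
Qed.

Lemma deck_before (sigma : 'S_n) (c d : 'I_n) :
    deck w = [seq sigma i | i <- enum 'I_n] ->
  (sigma^-1%g c < sigma^-1%g d)%N -> above c d.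
Proof.
move=> deckE lt_cd; have := deck_pairwise; rewrite deckE pairwise_map.
move/(pairwiseP c)/(_ (sigma^-1%g c) (sigma^-1%g d)).
by rewrite !inE size_enum_ord !ltn_ord !nth_ord_enum /= !permKV; apply.
Qed.

Lemma deck_des (sigma : 'S_n) (c d : 'I_n) :
    deck w = [seq sigma i | i <- enum 'I_n] -> val d = c.+1 ->
  (sigma^-1%g d < sigma^-1%g c)%N = letter_desc (w c) (w d).
Proof.
move=> deckE dE; have [above_cd above_dc] := aboveS dE.
case: ltngtP => [lt_dc | lt_cd | /val_inj/perm_inj dc].
- by rewrite -above_dc (deck_before deckE).
- by have := deck_before deckE lt_cd; rewrite above_cd => /negPf.
by move: dE; rewrite dc => /eqP; rewrite -[X in X == _]addn0 -addn1 eqn_add2l.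
Qed.

End Deck.

(** The last index has no successor, so [des] is a sum over the [n] pairs of
    consecutive cards. *)
Lemma des_deck n m (w : outcome n.+1 m) (sigma : 'S_n.+1) :
    deck w = [seq sigma i | i <- enum 'I_n.+1] ->
  des sigma^-1%g = word_des (@letter_desc m) w.
Proof.
move=> deckE; rewrite /des -sum1_card big_mkcond big_ord_recr /=.
rewrite inE ifF ?addn0; last first.
  by apply/existsP => -[j /andP[/eqP jE _]]; have := ltn_ord j; rewrite jE ltnn.
apply: eq_bigr => i _; rewrite inE -(deck_des deckE) //.
set b := (X in nat_of_bool X); suff -> : [exists j : 'I_n.+1,
    (val j == (widen_ord (leqnSn n) i).+1) &&
    (sigma^-1%g j < sigma^-1%g (widen_ord (leqnSn n) i))%N] = b by case: b.
apply/existsP/idP => [[j /andP[/eqP jE]] | ?].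
  by have -> : j = lift ord0 i by apply: val_inj; rewrite jE.
by exists (lift ord0 i); rewrite eqxx.
Qed.

(** Change of variables from permutations to outcomes, each outcome producing
    exactly one permutation. *)
Lemma gen_fun_shelf_law (R : realFieldType) n m (p : R) (X : 'S_n -> nat)
    (Y : outcome n m -> nat) :
    (forall (w : outcome n m) (sigma : 'S_n),
       deck w = [seq sigma i | i <- enum 'I_n] -> X sigma = Y w) ->
  gen_fun (shelf_law m p) X = \sum_w outcome_prob p w *: 'X^(Y w).
Proof.
move=> XY; rewrite /gen_fun /shelf_law.
under eq_bigr do rewrite scaler_suml.
rewrite (exchange_big_dep xpredT) //=; apply: eq_bigr => w _.
have [sigma deckE] : exists sigma : 'S_n,
    deck w = [seq sigma i | i <- enum 'I_n].
  have /tuple_permP[sigma deckE] : perm_eq (deck w) (ord_tuple n).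
    by rewrite val_ord_tuple deck_perm_eq.
  exists sigma; rewrite deckE /=; apply: eq_map => i.
  by rewrite tnth_ord_tuple.
rewrite (big_pred1 sigma) => [|tau /=]; first by rewrite (XY w).
rewrite deckE; apply/eqP/eqP => [/eq_in_map E | -> //]; apply/permP => i.
by rewrite E ?mem_enum.
Qed.

(** * The alphabet of shelves *)

Section Shelves.
Variables (R : fieldType) (m : nat) (u v : R).

Local Notation U := (fps_of_poly (1 + v *: 'X) / fps_of_poly (1 - u *: 'X)).

(** [U] enumerates the nondecreasing sequences on one shelf: such a sequence
    is empty, or begins with a top letter followed by anything, or is the
    single bottom letter. *)
Lemma shelf_seriesE :
  U = 1 + fps_of_poly 'X * (fps_of_poly u%:P * U + fps_of_poly v%:P).
Proof.
have unitD : fps_of_poly (1 - u *: 'X) \is a GRing.unit.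
  change (fcoef (fps_of_poly (1 - u *: 'X)) 0 != 0).
  by rewrite /= coefB coef1 coefZ coefX mulr0 subr0 oner_neq0.
apply: (mulIr unitD); rewrite divrK // mulrDl mul1r -mulrA.
rewrite [(_ + fps_of_poly v%:P) * _]mulrDl -[_ * U * _]mulrA divrK //.
rewrite -!rmorphM -rmorphD -rmorphM -rmorphD /=; congr fps_of_poly.
by rewrite -!mul_polyC; ring.
Qed.

Definition shelf_letter (a : 'I_m * bool) : R := if a.2 then u else v.

(** After a top letter of shelf [j] come shelf [j] itself and the later
    shelves, [m - j] shelves in all; after a bottom letter only the later
    ones. *)
Definition shelf_chains (a : 'I_m * bool) : fps R :=
  if a.2 then fps_of_poly u%:P * U ^+ (m - a.1)
  else fps_of_poly v%:P * U ^+ (m - a.1.+1).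

(** Both sides enumerate the sequences on the shelves of index at least [k].
    Adding one shelf in front multiplies by [U], by [shelf_seriesE]. *)
Lemma sum_shelf_chains k : (k <= m)%N ->
  1 + fps_of_poly 'X * \sum_(a : 'I_m * bool | (k <= a.1)%N) shelf_chains a =
  U ^+ (m - k).
Proof.
move=> le_km; rewrite -[in LHS](subKn le_km); have := leq_subr k m.
(* Induction on the number d = m - k of shelves. *)
elim: (m - k)%N => [|d IHd] le_dm.
  rewrite big_pred0 ?mulr0 ?addr0 // => a.
  by rewrite subn0 leqNgt ltn_ord.
have lt_m : (m - d.+1 < m)%N by rewrite ltn_subrL (leq_trans _ le_dm).
pose s := Ordinal lt_m.
rewrite (bigD1 (s, true)) //= (bigD1 (s, false)) ?leqnn ?xpair_eqE ?andbF //=.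
rewrite (eq_bigl (fun a : 'I_m * bool => (m - d <= a.1)%N)) => [|[j b]]; last first.
  (* Removing both letters of shelf m - d.+1 leaves those from m - d on. *)
  rewrite /= !xpair_eqE -!val_eqE /= -(subnSK le_dm) eq_sym.
  by case: (ltngtP (m - d.+1) j) => // _; case: b.
rewrite addrA mulrDr addrCA IHd ?(ltnW le_dm) // /shelf_chains /=.
rewrite subnSK // !subKn ?(ltnW le_dm) // exprS.
set P := _ ^+ d; rewrite [in RHS]shelf_seriesE.
set V := fps_of_poly (1 + _) / _; ring.
Qed.

Lemma shelf_chainsE a : shelf_chains a =
  fps_of_poly (shelf_letter a)%:P *
    (1 + fps_of_poly 'X * \sum_(b | ~~ letter_desc a b) shelf_chains b).
Proof.
case: a => s [] /=; rewrite /shelf_chains /shelf_letter /=; congr (_ * _).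
  rewrite -sum_shelf_chains ?(ltnW (ltn_ord s)) //.
  congr (_ + _ * _); apply: eq_bigl => b.
  by rewrite /letter_desc andbF orbF /= leqNgt.
rewrite -sum_shelf_chains //.
congr (_ + _ * _); apply: eq_bigl => b.
by rewrite /letter_desc andbT /= orbC -leq_eqVlt leqNgt.
Qed.

End Shelves.

(* The last factor is \sum_(k >= 1) t^k c_k, given by its coefficients. *)
Theorem theorem2p19 (R : realFieldType) (n m : nat) (p q : R)
    (hn : (1 <= n)%N) (hm : (1 <= m)%N) (hp0 : 0 < p) (hp1 : p < 1)
    (hq : q = 1 - p) :
  fps_of_poly (gen_fun (shelf_law m p)
                       (fun sigma : 'S_n => (des sigma^-1%g).+1)) =
  fps_of_poly (1 - 'X) ^+ n.+1 *
  Fps (fun k => if (1 <= k)%N then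
         fcoef ((fps_of_poly (1 + (q / m%:R) *: 'X)
                 / fps_of_poly (1 - (p / m%:R) *: 'X)) ^+ (k * m)) n
       else 0).
Proof.
case: n hn => // n _.
set U := fps_of_poly (1 + _) / _.
pose x := @shelf_letter R m (p / m%:R) (q / m%:R).
have EE : U ^+ m = 1 + fps_of_poly 'X *
    \sum_a shelf_chains (p / m%:R) (q / m%:R) (a : 'I_m * bool).
  by rewrite -[m in LHS]subn0 -sum_shelf_chains.
rewrite (@gen_fun_shelf_law _ _ _ _ _
  (fun w => (word_des (@letter_desc m) w).+1)); last first.
  by move=> w sigma /des_deck ->.
under eq_bigr do rewrite exprS scalerAr.
rewrite -mulr_sumr (eq_bigr (fun w : outcome n.+1 m =>
    (\prod_i x (w i)) *: 'X^(word_des (@letter_desc m) w))) => [|w _]; last first.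
  congr (_ *: _); apply: eq_bigr => i _.
  by rewrite /x /shelf_letter hq mulrC; case: (w i).2.
rewrite sum_word_gf -(word_gf_series (shelf_chainsE _ _) EE).
by congr (_ * _); apply: fpsP => -[|k] //=; rewrite mulnC exprM.
Qed.
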